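(* Let $z_1,\dots,z_k$ and $q$ be complex numbers with $|q|<1$, and let $F(m)$ be the terms of the expansion $$\prod_{m=1}^{\infty}(1+z_1q^m)(1+z_2q^m)\cdots(1+z_kq^m)=\sum_{m=0}^{\infty}F(m)$$ that are given recursively by $$F(m)=\frac{q^m}{1-q^m}\sum_{n=1}^{k}S_n^k(z_1,z_2,\dots,z_k)\,F(m-n),$$ with $F(m)=0$ for $m<0$, $F(0)=1$, and $F(1)=\frac{q}{1-q}\sum_{i=1}^{k}z_i=\frac{q}{1-q}S_1^k(z_1,\dots,z_k)$. For positive integers $m$, define $P(m)$ such that $$F(m)=\frac{q^mP(m)}{(q)_m},$$ with $P(0)=1$ and $P(m)=0$ for $m<0$. Then $$\prod_{m=1}^{\infty}(1+z_1q^m)(1+z_2q^m)\cdots(1+z_kq^m)=\sum_{m=0}^{\infty}\frac{q^m}{(q)_m}P(m).$$ Moreover, for positive integers $m$, $P(m)$ satisfies the recurrence $$P(m)=\sum_{i=1}^{k}\frac{q^{m-i}\,(q)_{m-1}}{(q)_{m-i}}\,S_i^k(z_1,z_2,\dots,z_k)\,P(m-i),$$ where terms with $i>m$ are $0$.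
   Context: $k$ is a positive integer. $(q)_n:=\prod_{j=1}^{n}(1-q^j)$ for $n\ge 0$ (so $(q)_0=1$). $S_n^k(z_1,\dots,z_k):=\sum_{1\le i_1<\cdots<i_n\le k}z_{i_1}z_{i_2}\cdots z_{i_n}$ is the elementary symmetric polynomial of degree $n$ in the variables $z_1,\dots,z_k$.
   Formalization: For q = 0 the relation F(m) = q^m P(m)/(q)_m does not determine P(m), so the recurrence is proved for every such P only when q ≠ 0; for q = 0 it is proved that some P satisfies both the relation and the recurrence. *)

(* Defs.v *)
From mathcomp Require Import all_boot all_order all_algebra.
From mathcomp Require Import all_classical all_reals all_analysis.
From mathcomp Require Export complex.
From mathcomp Require mpoly.

Set Implicit Arguments.
Unset Strict Implicit.
Unset Printing Implicit Defensive.

Import Order.TTheory GRing.Theory Num.Theory.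
Import numFieldNormedType.Exports.

Local Open Scope classical_set_scope.
Local Open Scope ring_scope.

Section Notions.
Variable C : numFieldType.

Definition qpoch (q : C) (n : nat) : C := \prod_(1 <= j < n.+1) (1 - q ^+ j).

Definition elem_sym (k : nat) (z : 'I_k -> C) (n : nat) : C :=
  mpoly.meval z (mpoly.mesym k C n).

Definition partial_prod (k : nat) (z : 'I_k -> C) (q : C) (N : nat) : C :=
  \prod_(1 <= m < N.+1) \prod_(i < k) (1 + z i * q ^+ m).

(* The indices are integers because the recursion reaches F(m - n) with
   m < n.  The value at 1 is also the case m = 1 of the recursion. *)
Definition expansion_terms (k : nat) (z : 'I_k -> C) (q : C) (F : int -> C)
    : Prop :=
  [/\ forall m : int, m < 0 -> F m = 0,
      F 0 = 1,
      F 1 = q / (1 - q) * \sum_(i < k) z i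
    & forall m : nat, (0 < m)%N ->
        F m%:Z = q ^+ m / (1 - q ^+ m) *
                 \sum_(1 <= n < k.+1) elem_sym z n * F (m%:Z - n%:Z)].

(* For q = 0 these conditions do not determine P m for m > 0: both sides of
   the last equation are then 0. *)
Definition normalized_terms (q : C) (F P : int -> C) : Prop :=
  [/\ forall m : int, m < 0 -> P m = 0,
      P 0 = 1
    & forall m : nat, (0 < m)%N ->
        F m%:Z = q ^+ m * P m%:Z / qpoch q m].

Definition normalized_recurrence (k : nat) (z : 'I_k -> C) (q : C)
    (P : int -> C) : Prop :=
  forall m : nat, (0 < m)%N ->
    P m%:Z = \sum_(1 <= i < k.+1 | (i <= m)%N)
               q ^+ (m - i) * qpoch q m.-1 / qpoch q (m - i) *
               elem_sym z i * P (m%:Z - i%:Z).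

Definition has_sum (a : nat -> C) (L : C) : Prop := series a @ \oo --> L.

Definition has_infprod (k : nat) (z : 'I_k -> C) (q L : C) : Prop :=
  partial_prod z q @ \oo --> L.

End Notions.

(* Main.v *)
Require Import Defs.
From mathcomp Require Import all_boot all_order all_algebra.
From mathcomp Require Import all_classical all_reals all_analysis.
From mathcomp Require Import ring.

Import Order.TTheory GRing.Theory Num.Theory.
Import numFieldNormedType.Exports.

Local Open Scope classical_set_scope.
Local Open Scope ring_scope.

(** Put [f x = \sum_m F m * x ^+ m]. The recursion of [F] is the coefficientwise
    form of the functional equation
      [f x = \prod_i (1 + z i * (q * x)) * f (q * x)],
    because [\prod_i (1 + z i * y)] is the generating function of the elementary
    symmetric polynomials ([prod_elem_sym], [expansion_terms_dilation],
    [has_sum_dilation]). Iterating it [N] times from [x = 1] gives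
      [f 1 = partial_prod z q N * f (q ^+ N)]
    ([has_sum_partial_prod]). As [q ^+ N] tends to [0] and [f] is continuous at
    [0] with [f 0 = F 0 = 1] ([has_sum_near1]), the partial products converge to
    [f 1], the sum of the [F m] ([partial_prod_cvg]).

    The analytic input is the bound [`|F m| <= B * `|q| ^+ m]
    ([expansion_terms_decay]), which makes the series converge for [`|x| <= 1].
    It comes from the factor [q ^+ m] of the recursion: this factor tends to
    [0], so the terms are bounded, and then one more step of the recursion turns
    boundedness into geometric decay.

    The recurrence of [P] is the recursion of [F] divided by
    [q ^+ m / qpoch q m] ([normalized_step]). For [q != 0] the division is
    legitimate for every normalizing [P]; for arbitrary [q] the [P] defined by
    the recurrence normalizes [F], by induction on [m]. *)

Set Implicit Arguments.
Unset Strict Implicit.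
Unset Printing Implicit Defensive.

(** * Complex sequences and series *)

(** The metric characterization in a form that unifies for the number field
    [R[i]], whose topology is that of its [numFieldType] structure. *)
Lemma cvg_seqP (C : numFieldType) (u : nat -> C) (l : C) :
  u @ \oo --> l <->
  forall e : C, 0 < e -> \forall n \near \oo, `|l - u n| < e.
Proof. exact: cvgrPdist_lt. Qed.

Lemma normc_ge_Im (R : rcfType) (x : R[i]) :
  `|complex.Im x|%:C%C <= `|x|.
Proof.
have := normc_ge_Re (complex.Complex (complex.Im x) (complex.Re x)).
by rewrite [in leRHS]normc_def [`|x|]normc_def /= addrC.
Qed.

Lemma Re_norm (R : rcfType) (x : R[i]) : (complex.Re `|x|)%:C%C = `|x|.
Proof. by rewrite RRe_real. Qed.

Lemma cvg_complex (R : realType) (u : nat -> R[i]) (a b : R) :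
  (fun n => complex.Re (u n)) @ \oo --> a ->
  (fun n => complex.Im (u n)) @ \oo --> b ->
  u @ \oo --> (complex.Complex a b : (R[i] : numFieldType)).
Proof.
move=> ua ub; apply/cvg_seqP => e e0.
have eE : e = (complex.Re e)%:C%C by rewrite RRe_real // gtr0_real.
have re0 : 0 < complex.Re e / 2 by rewrite divr_gt0 // -ltcR -eE.
near=> n.
have dE : complex.Complex a b - u n =
    (a - complex.Re (u n))%:C%C + 'i%C * (b - complex.Im (u n))%:C%C.
  case: (u n) => c d; apply/eqP; rewrite eq_complex /=.
  by apply/andP; split; apply/eqP; ring.
rewrite dE (le_lt_trans (ler_normD _ _)) // normrM.
have -> : `|'i%C : R[i]| = 1.
  by rewrite normc_def /= expr0n /= add0r expr1n sqrtr1.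
rewrite mul1r !normc_def /= !expr0n /= !addr0 !sqrtr_sqr -rmorphD /= eE ltcR.
rewrite [ltRHS]splitr; apply: ltrD; near: n.
  by move/cvg_seqP: ua; apply.
by move/cvg_seqP: ub; apply.
Unshelve. all: by end_near.
Qed.

(** Comparison test. Completeness is used over the reals only, for the series
    of real parts and the series of imaginary parts, each of which inherits the
    bound [v]. *)
Lemma has_sum_dominated (R : realType) (a : nat -> R[i]) (v : nat -> R) :
  (forall n, `|a n| <= (v n)%:C%C) -> cvgn (series v) ->
  exists L : R[i], has_sum a L.
Proof.
move=> av cv.
have component (f : R[i] -> R) (fD : {morph f : x y / x + y}) (f0 : f 0 = 0) :
    (forall x, `|f x|%:C%C <= `|x|) -> cvgn (fun n => f (series a n)).
  move=> fx.
  have -> : (fun n => f (series a n)) = series (f \o a).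
    by apply/funext => n; rewrite /series /= (big_morph f fD f0).
  have v0 n : 0 <= v n by rewrite -lecR; exact: le_trans (normr_ge0 _) (av n).
  apply: (@normed_cvg R R^o).
  apply: (@series_le_cvg R _ v _ v0 _ cv) => n /=; first exact: normr_ge0.
  by rewrite -lecR (le_trans (fx _)).
have cRe := component (@complex.Re R) (fun x y => raddfD _ x y) (raddf0 _)
  (@normc_ge_Re R).
have cIm := component (@complex.Im R) (fun x y => raddfD _ x y) (raddf0 _)
  (@normc_ge_Im R).
exists (complex.Complex (limn (fun n => complex.Re (series a n)))
                (limn (fun n => complex.Im (series a n)))).
exact: cvg_complex.
Qed.

Lemma has_sum_unique (C : numFieldType) (a : nat -> C) (L L' : C) :
  has_sum a L -> has_sum a L' -> L = L'.
Proof. exact: cvg_unique. Qed.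

Lemma cvg_expr_complex (R : realType) (q : R[i]) : `|q| < 1 ->
  (fun n => q ^+ n) @ \oo --> (0 : (R[i] : numFieldType)).
Proof.
move=> q1; apply/cvg_seqP => e e0.
have eE : e = (complex.Re e)%:C%C by rewrite RRe_real // gtr0_real.
have re0 : 0 < complex.Re e by rewrite -ltcR -eE.
have r1 : `|complex.Re `|q| | < 1.
  have r0 : 0 <= complex.Re `|q| by rewrite -lecR Re_norm; exact: normr_ge0.
  by rewrite ger0_norm // -ltcR Re_norm.
have := cvg_expr r1 => /cvg_seqP /(_ _ re0).
apply: filterS => n; rewrite !sub0r !normrN => rn.
by rewrite normrX -Re_norm -rmorphXn [ltRHS]eE ltcR (le_lt_trans (ler_norm _)).
Qed.

(** * The recursion as a functional equation *)

Lemma one_subX_neq0 (C : numFieldType) (q : C) (m : nat) :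
  `|q| < 1 -> (0 < m)%N -> 1 - q ^+ m != 0.
Proof.
move=> q1 m0; rewrite subr_eq0; apply/eqP => qm.
have := exprn_ilt1 m (normr_ge0 q) q1.
by rewrite -lt0n m0 -normrX -qm normr1 ltxx.
Qed.

Lemma elem_sym0 (C : numFieldType) (k : nat) (z : 'I_k -> C) : elem_sym z 0 = 1.
Proof. by rewrite /elem_sym mpoly.mesym0E mpoly.meval1. Qed.

(** The generating function of the elementary symmetric polynomials: expanding
    the product chooses a subset of the indices, and the subsets are grouped by
    cardinality. *)
Lemma prod_elem_sym (C : numFieldType) (k : nat) (z : 'I_k -> C) (y : C) :
  \prod_(i < k) (1 + z i * y) = \sum_(0 <= n < k.+1) elem_sym z n * y ^+ n.
Proof.
have -> : \prod_(i < k) (1 + z i * y) =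
    \sum_(J : {set 'I_k}) \prod_(i in J) (z i * y).
  rewrite (eq_bigr (fun i => z i * y + 1)); last by move=> i _; rewrite addrC.
  rewrite bigA_distr; apply: eq_bigr => J _.
  by rewrite [RHS]big_mkcond.
rewrite (partition_big (fun J : {set 'I_k} => inord #|J| : 'I_k.+1) xpredT) //=.
rewrite big_mkord; apply: eq_bigr => n _.
rewrite /elem_sym mpoly.mesymE.
rewrite (big_morph _ (mpoly.mevalD z) (mpoly.meval0 z)) /= mulr_suml.
have cardJ (J : {set 'I_k}) : (inord #|J| == n :> 'I_k.+1) = (#|J| == n)%N.
  by rewrite -val_eqE /= inordK // ltnS -[X in (_ <= X)%N]card_ord max_card.
apply: eq_big => [J|J Jn]; first exact: cardJ.
rewrite big_split /= prodr_const (eqP (etrans (esym (cardJ J)) Jn)).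
congr (_ * _).
rewrite mpoly.mevalX [LHS]big_mkcond /=; apply: eq_bigr => i _.
by rewrite mpoly.mnmE; case: (i \in J).
Qed.

(** Moving [q ^+ m * F m] to the right-hand side of the recursion adds the term
    [n = 0] to the sum and removes the denominator. This is the recursion read
    as the coefficient of [x ^+ m] in
      [f x = \prod_i (1 + z i * (q * x)) * f (q * x)];
    in this form it also holds at [m = 0]. *)
Lemma expansion_terms_dilation (C : numFieldType) (k : nat) (z : 'I_k -> C)
    (q : C) (F : int -> C) (q1 : `|q| < 1) :
  expansion_terms z q F -> forall m : nat,
  F m%:Z = q ^+ m * \sum_(0 <= n < k.+1) elem_sym z n * F (m%:Z - n%:Z).
Proof.
move=> [F0 F1 _ Frec] [|m].
  rewrite expr0 mul1r big_nat_recl // big1 ?addr0 => [|n _].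
    by rewrite elem_sym0 mul1r.
  by rewrite F0 ?mulr0 // sub0r oppr_lt0.
rewrite big_ltn // elem_sym0 mul1r subr0.
have q0 := @one_subX_neq0 _ q m.+1 q1 isT.
have := Frec m.+1 isT; move: (\sum_(_ <= _ < _) _) (F _) q0 => S f q0 ->.
by move: (q ^+ _) q0 => a a0; field.
Qed.

Lemma shifted_sum (C : numFieldType) (F : int -> C) (y : C) (n M : nat) :
  (forall m : int, m < 0 -> F m = 0) ->
  \sum_(0 <= m < M) F (m%:Z - n%:Z) * y ^+ m =
  y ^+ n * \sum_(0 <= m < M - n) F m%:Z * y ^+ m.
Proof.
move=> F0; elim: M => [|M IH]; first by rewrite !big_geq ?mulr0.
rewrite big_nat_recr //= IH; have [nM|Mn] := leqP n M.
  rewrite subSn // big_nat_recr //= mulrDr; congr (_ + _).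
  by rewrite mulrCA -exprD subnKC // subzn.
have Mn0 : M%:Z - n%:Z < 0 by rewrite subr_lt0.
have [-> ->] : (M - n = 0)%N /\ (M.+1 - n = 0)%N.
  by split; apply/eqP; rewrite subn_eq0 // ltnW.
by rewrite (F0 _ Mn0) mul0r addr0.
Qed.

(** The functional equation holds exactly for partial sums, provided that the
    sum multiplying the coefficient of degree [n] is cut [n] terms earlier. *)
Lemma dilation_partial_sums (C : numFieldType) (k : nat) (z : 'I_k -> C)
    (q : C) (F : int -> C) (q1 : `|q| < 1) : expansion_terms z q F ->
  forall (x : C) (M : nat),
  series (fun m => F m%:Z * x ^+ m) M =
  \sum_(0 <= n < k.+1) elem_sym z n * (q * x) ^+ n *
     series (fun m => F m%:Z * (q * x) ^+ m) (M - n)%N.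
Proof.
move=> hF x M; have [F0 _ _ _] := hF.
transitivity (\sum_(0 <= m < M) \sum_(0 <= n < k.+1)
    elem_sym z n * (F (m%:Z - n%:Z) * (q * x) ^+ m)).
  apply: eq_bigr => m _; rewrite (expansion_terms_dilation q1 hF).
  rewrite mulrAC -exprMn mulr_sumr; apply: eq_bigr => n _.
  by rewrite mulrCA [_ * F _]mulrC.
rewrite exchange_big /=; apply: eq_bigr => n _.
by rewrite -mulr_sumr shifted_sum // mulrA.
Qed.

(** * Decay of the terms *)

(** One step of the recursion, with the constant split into the factor
    [`|q| ^+ m], which gives the decay, and a factor that does not depend on
    [m]. *)
Lemma expansion_terms_le (C : numFieldType) (k : nat) (z : 'I_k -> C)
    (q : C) (F : int -> C) (q1 : `|q| < 1) : expansion_terms z q F ->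
  forall (B : C) (m : nat), 0 <= B -> (0 < m)%N ->
  (forall j : nat, (j < m)%N -> `|F j%:Z| <= B) ->
  `|F m%:Z| <=
    `|q| ^+ m * ((\sum_(1 <= n < k.+1) `|elem_sym z n|) / (1 - `|q|) * B).
Proof.
move=> [F0 _ _ Frec] B m B0 mgt0 FB.
have q1' : 0 < 1 - `|q| by rewrite subr_gt0.
have qm1 : 1 - `|q| <= `|1 - q ^+ m|.
  rewrite (le_trans _ (lerB_dist _ _)) // normr1 lerD2l lerN2 normrX.
  by rewrite -[leRHS]expr1; apply: ler_wiXn2l => //; exact: ltW.
rewrite Frec // !normrM normfV normrX -!mulrA ler_wpM2l ?exprn_ge0 //.
rewrite [leRHS]mulrCA; apply: ler_pM; rewrite ?invr_ge0 //.
  by rewrite lef_pV2 ?posrE // (lt_le_trans q1').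
rewrite mulr_suml (le_trans (ler_norm_sum _ _ _)) //.
rewrite big_nat_cond [leRHS]big_nat_cond.
apply: ler_sum => n /andP[/andP[n0 _] _].
rewrite normrM ler_wpM2l //.
have [nm|mn] := leqP n m.
  by rewrite subzn // FB // ltn_subrL n0.
have mn0 : m%:Z - n%:Z < 0 by rewrite subr_lt0.
by rewrite (F0 _ mn0) normr0.
Qed.

(** Once [`|q| ^+ m] is small enough to absorb the constant of
    [expansion_terms_le], every bound of the earlier terms also bounds the next
    one; before that there are finitely many terms. *)
Lemma expansion_terms_bounded (R : realType) (k : nat) (z : 'I_k -> R[i])
    (q : R[i]) (F : int -> R[i]) (q1 : `|q| < 1) : expansion_terms z q F ->
  exists2 B : R[i], 0 <= B & forall m : nat, `|F m%:Z| <= B.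
Proof.
move=> hF.
pose E : R[i] := (\sum_(1 <= n < k.+1) `|elem_sym z n|) / (1 - `|q|).
have E0 : 0 <= E by rewrite divr_ge0 ?sumr_ge0 // subr_ge0 ltW.
have E1 : 0 < E + 1 by rewrite ltr_wpDl.
(* [E + 1] instead of [E], which may be [0], to have a positive threshold. *)
have [m0 _ hm0] := (cvg_seqP _ _).1 (cvg_expr_complex q1) (E + 1)^-1
  (etrans (invr_gt0 _) E1).
pose B : R[i] := \sum_(0 <= j < m0.+1) `|F j%:Z|.
have B0 : 0 <= B by apply: sumr_ge0.
exists B => //; elim/ltn_ind => m IH.
have [mm0|m0m] := ltnP m m0.+1.
  by rewrite /B (bigD1_seq m) ?iota_uniq ?mem_index_iota //= lerDl sumr_ge0.
have mgt0 : (0 < m)%N by apply: leq_ltn_trans m0m.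
apply: le_trans (expansion_terms_le q1 hF B0 mgt0 IH) _.
rewrite mulrA ler_piMl // (@le_trans _ _ ((E + 1)^-1 * E)) //.
  apply: ler_wpM2r => //.
  by have := hm0 m (ltnW m0m); rewrite /= sub0r normrN normrX => /ltW.
by rewrite mulrC ler_pdivrMr // mul1r lerDl.
Qed.

(** Boundedness improves itself: one more step of the recursion multiplies the
    bound by [`|q| ^+ m]. *)
Lemma expansion_terms_decay (R : realType) (k : nat) (z : 'I_k -> R[i])
    (q : R[i]) (F : int -> R[i]) (q1 : `|q| < 1) : expansion_terms z q F ->
  exists2 B : R[i], 0 <= B & forall m : nat, `|F m%:Z| <= B * `|q| ^+ m.
Proof.
move=> hF; have [B B0 FB] := expansion_terms_bounded q1 hF.
pose E : R[i] := (\sum_(1 <= n < k.+1) `|elem_sym z n|) / (1 - `|q|).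
have E0 : 0 <= E by rewrite divr_ge0 ?sumr_ge0 // subr_ge0 ltW.
exists (B + E * B); first by rewrite addr_ge0 // mulr_ge0.
case=> [|m]; first by rewrite expr0 mulr1 (le_trans (FB 0%N)) // lerDl mulr_ge0.
apply: le_trans (expansion_terms_le q1 hF B0 (ltn0Sn m) (fun j _ => FB j)) _.
by rewrite mulrC ler_wpM2r ?exprn_ge0 // lerDr.
Qed.

Lemma has_sum_expansion (R : realType) (k : nat) (z : 'I_k -> R[i])
    (q : R[i]) (F : int -> R[i]) (q1 : `|q| < 1) : expansion_terms z q F ->
  forall x : R[i], `|x| <= 1 ->
  exists L : R[i], has_sum (fun m => F m%:Z * x ^+ m) L.
Proof.
move=> hF x x1; have [B B0 FB] := expansion_terms_decay q1 hF.
apply: (@has_sum_dominated _ _ (geometric (complex.Re B) (complex.Re `|q|))).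
  move=> m; rewrite /= rmorphM rmorphXn /= Re_norm RRe_real ?ger0_real //.
  rewrite normrM normrX (le_trans _ (FB m)) // ler_piMr // exprn_ile1 //.
apply/cvg_ex; exists (complex.Re B / (1 - complex.Re `|q|)).
apply: cvg_geometric_series; rewrite ger0_norm -?lecR -?ltcR Re_norm //.
exact: normr_ge0.
Qed.

(** * Convergence of the product *)

(** The functional equation of [f x = \sum_m F m * x ^+ m], as the limit of
    [dilation_partial_sums]. *)
Lemma has_sum_dilation (C : numFieldType) (k : nat) (z : 'I_k -> C)
    (q : C) (F : int -> C) (q1 : `|q| < 1) : expansion_terms z q F ->
  forall x L : C, has_sum (fun m => F m%:Z * (q * x) ^+ m) L ->
  has_sum (fun m => F m%:Z * x ^+ m) ((\prod_(i < k) (1 + z i * (q * x))) * L).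
Proof.
move=> hF x L hL; rewrite prod_elem_sym mulr_suml /has_sum.
have -> : series (fun m => F m%:Z * x ^+ m) = fun M =>
  \sum_(0 <= n < k.+1) elem_sym z n * (q * x) ^+ n *
     series (fun m => F m%:Z * (q * x) ^+ m) (M - n)%N.
  by apply/funext => M; exact: dilation_partial_sums.
apply: cvg_big => [|n _]; first exact: add_continuous.
apply: cvgM; first exact: cvg_cst.
by rewrite (cvg_centern n (series _)).
Qed.

(** Iterating the functional equation from [q ^+ N] up to [1] collects exactly
    the factors of the [N]-th partial product. *)
Lemma has_sum_partial_prod (C : numFieldType) (k : nat) (z : 'I_k -> C)
    (q : C) (F : int -> C) (q1 : `|q| < 1) : expansion_terms z q F ->
  forall (N : nat) (L : C), has_sum (fun m => F m%:Z * (q ^+ N) ^+ m) L ->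
  has_sum (fun m => F m%:Z) (partial_prod z q N * L).
Proof.
move=> hF; elim=> [|N IH] L hL.
  rewrite /partial_prod big_geq // mul1r.
  congr (has_sum _ L): hL; apply/funext => m.
  by rewrite expr0 expr1n mulr1.
rewrite /partial_prod big_nat_recr //= -mulrA; apply: IH.
rewrite exprS in hL *; exact: has_sum_dilation.
Qed.

(** Continuity of [f] at [0] with an explicit modulus. The slack [e] stands for
    the tail of the series: only partial sums are estimated, so that no passage
    to the limit in an inequality is needed in the partially ordered field. *)
Lemma has_sum_near1 (C : numFieldType) (q : C) (F : int -> C) (B : C) :
  `|q| < 1 -> F 0 = 1 ->
  (forall m : nat, `|F m%:Z| <= B * `|q| ^+ m) ->
  forall x L : C, `|x| <= 1 -> has_sum (fun m => F m%:Z * x ^+ m) L ->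
  forall e : C, 0 < e -> `|L - 1| <= e + `|x| * (B / (1 - `|q|)).
Proof.
move=> q1 F0 FB x L x1 hL e e0.
have q1' : 0 < 1 - `|q| by rewrite subr_gt0.
have B0 : 0 <= B by have := FB 0%N; rewrite expr0 mulr1; apply: le_trans.
have [M _ hM] := (cvg_seqP _ _).1 hL e e0.
have -> : L - 1 = (L - series (fun m => F m%:Z * x ^+ m) M.+1) +
   \sum_(0 <= m < M) F m.+1%:Z * x ^+ m.+1.
  by rewrite /series /= big_nat_recl // F0 expr0 mulr1; ring.
apply: le_trans (ler_normD _ _) _; apply: lerD.
  exact: ltW (hM _ (leqnSn M)).
apply: (@le_trans _ _ (`|x| * series (geometric B `|q|) M)).
  rewrite /series /= mulr_sumr; apply: le_trans (ler_norm_sum _ _ _) _.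
  apply: ler_sum => m _; rewrite normrM normrX exprS mulrCA ler_wpM2l //.
  apply: (@le_trans _ _ `|F m.+1%:Z|).
    by rewrite ler_piMr // exprn_ile1.
  apply: le_trans (FB _) _; rewrite ler_wpM2l //.
  by rewrite exprS ler_piMl ?exprn_ge0 // ltW.
rewrite ler_wpM2l // geometric_seriesE ?lt_eqF //=.
rewrite ler_pM2r ?invr_gt0 // ler_piMr // gerBl exprn_ge0 //.
Qed.

(** Since [f 1 = partial_prod z q N * f (q ^+ N)] for all [N] and
    [f (q ^+ N)] tends to [1], the partial products tend to [f 1]. The
    convergence of the infinite product is thus a consequence and not an
    ingredient, and it holds even when the limit is [0]. *)
Lemma partial_prod_cvg (R : realType) (k : nat) (z : 'I_k -> R[i])
    (q : R[i]) (F : int -> R[i]) (q1 : `|q| < 1) : expansion_terms z q F ->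
  exists L : R[i], has_infprod z q L /\ has_sum (fun m => F m%:Z) L.
Proof.
move=> hF; have [B B0 FB] := expansion_terms_decay q1 hF.
have [_ F0 _ _] := hF.
have qN1 N : `|q ^+ N| <= 1 by rewrite normrX exprn_ile1 // ltW.
(* [f N] is the value at [q ^+ N] of the function called [f] above. *)
have [f fE] := choice (fun N => has_sum_expansion q1 hF (qN1 N)).
have sumF N := has_sum_partial_prod q1 hF (fE N).
pose L := f 0%N.
have pp0 : partial_prod z q 0 = 1 by rewrite /partial_prod big_geq.
have sumL : has_sum (fun m : nat => F m%:Z) L.
  by rewrite -[L]mul1r -pp0; apply: sumF.
have LE N : L = partial_prod z q N * f N.
  by apply: has_sum_unique (sumF N).
exists L; split => //.
(* [+ 1] makes [K] positive, so that one can divide by it. *)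
pose K := B / (1 - `|q|) + 1.
have K0 : 0 < K by rewrite ltr_wpDl // divr_ge0 // subr_ge0 ltW.
have f1 : f @ \oo --> (1 : (R[i] : numFieldType)).
  apply/cvg_seqP => e e0.
  have e2 : 0 < e / 2 by rewrite divr_gt0.
  have e2K : 0 < e / 2 / K by rewrite divr_gt0.
  have := (cvg_seqP _ _).1 (cvg_expr_complex q1) _ e2K.
  apply: filterS => N; rewrite sub0r normrN ltr_pdivlMr // => qN.
  rewrite distrC.
  apply: le_lt_trans (has_sum_near1 q1 F0 FB (qN1 N) (fE N) e2) _.
  rewrite [ltRHS]splitr ltrD2l (le_lt_trans _ qN) // ler_wpM2l //.
  by rewrite lerDl.
have fV : (fun N => L / f N) @ \oo --> (L : (R[i] : numFieldType)).
  rewrite -[X in _ --> X]mulr1 -[X in _ * X]invr1.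
  by apply: cvgM; [exact: cvg_cst | apply: cvgV => //; exact: oner_neq0].
apply: cvg_trans fV; apply: near_eq_cvg.
have := (cvg_seqP _ _).1 f1 1 ltr01; apply: filterS => N fN1.
have fN : f N != 0 by apply: contraTneq fN1 => ->; rewrite subr0 normr1 ltxx.
by rewrite (LE N) mulfK.
Qed.

(** * The normalized terms *)

Lemma qpoch_neq0 (C : numFieldType) (q : C) (n : nat) :
  `|q| < 1 -> qpoch q n != 0.
Proof.
move=> q1; rewrite prodf_seq_neq0; apply/allP => j.
by rewrite mem_index_iota => /andP[j0 _] /=; exact: one_subX_neq0.
Qed.

Lemma qpoch_pred (C : numFieldType) (q : C) (m : nat) : (0 < m)%N ->
  qpoch q m = qpoch q m.-1 * (1 - q ^+ m).
Proof. by case: m => // m _; rewrite /qpoch big_nat_recr. Qed.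

(** The recursion of [F] and the recurrence of [P] differ by the factor
    [q ^+ m / qpoch q m]. Only the values below [m] are assumed normalized, so
    that the lemma serves both to derive the recurrence of a given [P] and to
    show by induction that a solution of the recurrence normalizes [F]. *)
Lemma normalized_step (C : numFieldType) (k : nat) (z : 'I_k -> C)
    (q : C) (F P : int -> C) (m : nat) : `|q| < 1 -> expansion_terms z q F ->
  (0 < m)%N ->
  (forall j : nat, (j < m)%N -> F j%:Z = q ^+ j * P j%:Z / qpoch q j) ->
  F m%:Z = q ^+ m / qpoch q m *
    \sum_(1 <= i < k.+1 | (i <= m)%N)
       q ^+ (m - i) * qpoch q m.-1 / qpoch q (m - i) *
       elem_sym z i * P (m%:Z - i%:Z).
Proof.
move=> q1 [F0 _ _ Frec] m0 FP.
rewrite Frec // !mulr_sumr [RHS]big_mkcond /=.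
apply: eq_big_nat => i /andP[i0 _].
case: leqP => [im|mi].
  rewrite subzn // FP; last by rewrite ltn_subrL i0.
  rewrite (qpoch_pred q m0).
  have := one_subX_neq0 q1 m0.
  have := qpoch_neq0 (m - i) q1.
  have := qpoch_neq0 m.-1 q1.
  move: (qpoch _ _) (qpoch _ _) (1 - _) (P _) => a b c p a0 b0 c0.
  by field; rewrite a0 b0 c0.
have mi0 : m%:Z - i%:Z < 0 by rewrite subr_lt0.
by rewrite (F0 _ mi0) !mulr0.
Qed.

(** For [q != 0] the normalizing factor can be cancelled, hence [P] is
    determined by [F]. *)
Lemma normalized_terms_recurrence (C : numFieldType) (k : nat) (z : 'I_k -> C)
    (q : C) (F P : int -> C) : `|q| < 1 -> expansion_terms z q F ->
  normalized_terms q F P -> q != 0 -> normalized_recurrence z q P.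
Proof.
move=> q1 hF [_ P0 FP] q0 m m0.
have [_ F0 _ _] := hF.
have FP' j : F j%:Z = q ^+ j * P j%:Z / qpoch q j.
  case: j => [|j]; last exact: FP.
  by rewrite F0 P0 /qpoch big_geq // expr0 mulr1 divr1.
have c0 : q ^+ m / qpoch q m != 0.
  by rewrite mulf_neq0 ?expf_neq0 // invr_eq0 qpoch_neq0.
apply: (mulfI c0); rewrite -(normalized_step q1 hF m0 (fun j _ => FP' j)) FP'.
by rewrite mulrAC.
Qed.

(** Each value depends on up to [k] earlier ones, so the recursion carries the
    list of all the values computed so far, the latest first. *)
Lemma exists_normalized_recurrence (C : numFieldType) (k : nat) (z : 'I_k -> C)
    (q : C) : exists P : int -> C,
  [/\ forall m : int, m < 0 -> P m = 0, P 0 = 1 & normalized_recurrence z q P].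
Proof.
pose c m i := q ^+ (m - i) * qpoch q m.-1 / qpoch q (m - i) * elem_sym z i.
pose next (s : seq C) :=
  \sum_(1 <= i < k.+1 | (i <= size s)%N) c (size s) i * s`_i.-1.
pose hist := fix hist n :=
  if n is n'.+1 then next (hist n') :: hist n' else [:: 1].
pose p n := head 0 (hist n).
have size_hist n : size (hist n) = n.+1 by elim: n => //= n ->.
have nth_hist n i : (i <= n)%N -> (hist n)`_i = p (n - i)%N.
  elim: n i => [|n IH] [|i] //= ilen; by rewrite IH.
exists (fun m => if m is Posz n then p n else 0); split=> //.
  by case.
case=> // m _.
rewrite [LHS]/p /= /next size_hist [LHS]big_nat_cond [RHS]big_nat_cond.
apply: eq_bigr => -[|i] // /andP[_ im]; congr (_ * _).
by rewrite subzn // nth_hist.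
Qed.

(** * The expansion of the product *)

Unset Implicit Arguments.

Theorem corollary6p6 (R : realType) (k : nat) (hk : (0 < k)%N)
    (z : 'I_k -> R[i]) (q : R[i]) (hq : `|q| < 1)
    (F : int -> R[i]) (hF : expansion_terms z q F) :
  (exists L : R[i],
     [/\ has_infprod z q L,
         has_sum (fun m : nat => F m%:Z) L
       & forall P : int -> R[i], normalized_terms q F P ->
           has_sum (fun m : nat => q ^+ m / qpoch q m * P m%:Z) L]) /\
  (forall P : int -> R[i], normalized_terms q F P ->
     q != 0 -> normalized_recurrence z q P) /\
  (exists P : int -> R[i],
     normalized_terms q F P /\ normalized_recurrence z q P).
Proof.
have [_ F0 _ _] := hF.
split; last split.
- have [L [prodL sumL]] := partial_prod_cvg hq hF.
  exists L; split=> // P [_ P0 FP].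
  congr (has_sum _ L): sumL; apply/funext => -[|m].
    by rewrite F0 P0 /qpoch big_geq // expr0 mulr1 divr1.
  by rewrite FP // mulrAC.
- by move=> P; apply: normalized_terms_recurrence hq hF.
have [P [Pneg P0 Prec]] := exists_normalized_recurrence z q.
exists P; split=> //; split=> //.
have FP (m : nat) : F m%:Z = q ^+ m * P m%:Z / qpoch q m.
  elim/ltn_ind: m => -[_|m IH].
    by rewrite F0 P0 /qpoch big_geq // expr0 mulr1 divr1.
  by rewrite (normalized_step hq hF (ltn0Sn m) IH) -Prec // mulrAC.
by move=> m _; exact: FP.
Qed.
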